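(* Let $n=2k+1\in\mathbb N$ with $k\ge 1$, and let $G=K_n$ denote the complete graph on $n$ vertices. The corresponding Lie algebra $\mathfrak n_G$ is non-integrable.
   Context: All Lie algebras are real. For a directed graph $G$ with at least one edge, with vertex set $S=\{X_1,\dots,X_m\}$ and edge set $E=\{Z_1,\dots,Z_q\}$, the 2-step nilpotent Lie algebra $\mathfrak n_G$ is the vector space direct sum $\mathfrak n_G=\mathfrak v\oplus\mathfrak z$, where $S$ is a basis of $\mathfrak v$ over $\mathbb R$ and $E$ is a basis of $\mathfrak z$ over $\mathbb R$. Its bracket is the bilinear skew-symmetric bracket for which the elements of $\mathfrak z$ are central, $[X_i,X_l]=Z_k$ if $Z_k$ is a directed edge from $X_i$ to $X_l$, and $[X_i,X_l]=0$ if there is no edge between $X_i$ and $X_l$. The complete graph $K_n$ on $n$ vertices is the graph which has an edge between every pair of distinct vertices (each edge being given a direction). Let $\mathfrak n$ be a 2-step nilpotent Lie algebra and $\mathfrak n^*$ its dual space. For $\lambda\in\mathfrak n^*$ and $X\in\mathfrak n$, let $\mathrm{ad}^*(X)\lambda\in\mathfrak n^*$ be given by $(\mathrm{ad}^*(X)\lambda)(Y)=-\lambda([X,Y])$ for all $Y\in\mathfrak n$, and let $\mathfrak n_\lambda:=\{X\in\mathfrak n:\mathrm{ad}^*(X)\lambda=0\}$. A pair $\mu,\lambda\in\mathfrak n^*$ is called generic if $\dim[\mathfrak n_\lambda,\mathfrak n_\mu]$ is minimal. The Lie algebra $\mathfrak n$ is called non-integrable if for a dense open subset of generic pairs $\lambda,\mu$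 one has $[\mathfrak n_\lambda,\mathfrak n_\mu]\neq0$.
   Formalization: As λ = μ with dim n_λ least gives [n_λ,n_μ] = 0, literally generic pairs never have nonzero bracket; here generic means dim n_λ and dim n_μ are least and dim [n_λ,n_μ] is locally minimal, and the set of pairs is open and dense in n*×n*. *)

(* Defs.v *)
From HB Require Import structures.
From mathcomp Require Import all_boot all_order all_algebra.
From mathcomp Require Import all_classical all_reals all_analysis.

Set Implicit Arguments.
Unset Strict Implicit.
Unset Printing Implicit Defensive.

Import Order.TTheory GRing.Theory Num.Theory.
Import numFieldNormedType.Exports.
Local Open Scope classical_set_scope.
Local Open Scope ring_scope.

(** * Finite-dimensional Lie algebras *)

Record lie_algebra (F : fieldType) := LieAlgebra {
  lie_sort :> vectType F;
  bracket : {bilinear lie_sort -> lie_sort -> lie_sort};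
  bracket_alternating : forall x, bracket x x = 0;
  bracket_jacobi : forall x y z,
    bracket x (bracket y z) + bracket y (bracket z x)
      + bracket z (bracket x y) = 0 }.

Arguments bracket {F n} : rename.

Definition two_step_nilpotent (F : fieldType) (n : lie_algebra F) : Prop :=
  (exists x y : n, bracket x y != 0) /\
  (forall x y z : n, bracket (bracket x y) z = 0).

Section LieTheory.
Variables (F : fieldType) (n : lie_algebra F).
Implicit Types (x y : n) (U V W : {vspace n}).

Local Notation dual := 'Hom(n, F^o).

(* The linear span of all brackets of U and V; written on bases as for the
   product [prodv] of subspaces of an algebra (see [brackvP]). *)
Definition brackv U V : {vspace n} :=
  <<[seq bracket u v | u <- vbasis U, v <- vbasis V]>>%VS.

Definition ad_star x (l : dual) : dual :=
  linfun (fun y : n => - l (bracket x y)).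

(* n_l *)
Definition stab (l : dual) : {vspace n} := lker (linfun (ad_star^~ l)).

Lemma memv_brackv U V u v : u \in U -> v \in V -> bracket u v \in brackv U V.
Proof.
move=> /coord_vbasis-> /coord_vbasis->.
rewrite linear_sumlz; apply: memv_suml => i _.
rewrite linear_sumr; apply: memv_suml => j _.
rewrite linearZl_LR linearZr_LR /= !memvZ // memv_span //.
by apply/allpairsP; exists ((vbasis U)`_i, (vbasis V)`_j); rewrite !memt_nth.
Qed.

Lemma brackvP U V W :
  reflect (forall u v, u \in U -> v \in V -> bracket u v \in W)
          (brackv U V <= W)%VS.
Proof.
apply: (iffP idP) => [sUVW u v Uu Vv|sUVW].
  exact: subvP sUVW _ (memv_brackv Uu Vv).
by apply/span_subvP=> _ /allpairsP[[u v] /= [Uu Vv ->]]; rewrite sUVW ?vbasis_mem.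
Qed.

Lemma ad_starE x (l : dual) y :
  ad_star x l y = - l (bracket x y).
Proof.
have lin : linear (fun y : n => - l (bracket x y)).
  by move=> a u v; rewrite !linearD !linearZ_LR /= scalerN.
pose B := GRing.isLinear.Build F n F^o _ _ lin.
pose g : {linear n -> F^o} := HB.pack (fun y : n => - l (bracket x y)) B.
exact: (lfunE g).
Qed.

Lemma mem_stab x (l : dual) : (x \in stab l) = (ad_star x l == 0).
Proof.
have lin : linear (ad_star^~ l).
  move=> a u v; apply/lfunP => y.
  rewrite add_lfunE scale_lfunE !ad_starE linearDl linearZl_LR /=.
  by rewrite linearD linearZ /= opprD scalerN.
pose B := GRing.isLinear.Build F n dual _ _ lin.
pose g : {linear n -> dual} := HB.pack (ad_star^~ l) B.
by rewrite memv_ker (lfunE g).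
Qed.

End LieTheory.

(** * Topology of finite-dimensional real vector spaces *)

(* The canonical topology of W, transported from R^d by the linear
   coordinates r2v; linear automorphisms of R^d being homeomorphisms, it does
   not depend on the coordinates. *)
Definition fd_open (R : realType) (W : vectType R) (U : set W) : Prop :=
  open (@VectorInternalTheory.r2v R W @^-1` U).

Definition fd_dense (R : realType) (W : vectType R) (U : set W) : Prop :=
  forall O : set W, O !=set0 -> fd_open O -> O `&` U !=set0.

(** * Non-integrability *)

Section NonIntegrable.
Variables (R : realType) (n : lie_algebra R).
Local Notation dual := 'Hom(n, R^o).
Implicit Types l m : dual.

Definition regular l : Prop :=
  forall l', (\dim (stab l) <= \dim (stab l'))%N.

(* The dimension of [n_l, n_m] cannot be required to be the least one over all
   of n^* x n^*: since [n_l, n_l] = 0 for every regular l, that least dimension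
   is always 0, and no Lie algebra would be non-integrable. As in Butler's
   definition, l and m are regular; the minimality of dim [n_l, n_m] is the
   local one. *)
Definition generic_pair l m : Prop :=
  [/\ regular l, regular m &
    exists O : set (dual * dual)%type,
      [/\ fd_open O, O (l, m) &
        forall l' m', O (l', m') ->
          (\dim (brackv (stab l) (stab m))
             <= \dim (brackv (stab l') (stab m')))%N]].

(* The set U of generic pairs is open and dense in n^* x n^*, hence also
   relatively open and dense in the set of generic pairs. *)
Definition nonintegrable : Prop :=
  exists U : set (dual * dual)%type,
    [/\ fd_open U, fd_dense U,
        forall l m, U (l, m) -> generic_pair l m
      & forall l m, U (l, m) -> brackv (stab l) (stab m) != 0%VS].

End NonIntegrable.

(** * The Lie algebra of a directed graph *)

(* At most one directed edge joins two vertices, and there is no loop: otherwise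
   [X_i, X_l] = Z_k would be ambiguous, or contradict skew-symmetry. *)
Record digraph (V : finType) := Digraph {
  arc :> rel V;
  arc_irr : irreflexive arc;
  arc_asym : forall i j, arc i j -> ~~ arc j i }.

Definition complete_graph (V : finType) (G : digraph V) : Prop :=
  forall i j, i != j -> arc G i j || arc G j i.

Section GraphLie.
Variables (F : fieldType) (V : finType) (G : digraph V).

Definition edge : finType := {p : V * V | arc G p.1 p.2}.

(* v (+) z, coordinates in the bases S = V and E = edge *)
Definition graph_space : vectType F := ({ffun V -> F^o} * {ffun edge -> F^o})%type.

Definition vertex_vec (i : V) : graph_space := ([ffun j => (j == i)%:R], 0).
Definition edge_vec (e : edge) : graph_space := (0, [ffun e' => (e' == e)%:R]).

(* The bilinear extension of [X_i, X_l] = Z_k, [X_l, X_i] = - Z_k for each edge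
   Z_k from X_i to X_l; see [graph_bracket_edge], [graph_bracket_nonadj] and
   [graph_bracket_central]. *)
Definition graph_bracket (x y : graph_space) : graph_space :=
  (0, [ffun e : edge => x.1 (val e).1 * y.1 (val e).2
                        - x.1 (val e).2 * y.1 (val e).1]).

Lemma graph_bracket_edge (e : edge) :
  graph_bracket (vertex_vec (val e).1) (vertex_vec (val e).2) = edge_vec e.
Proof.
congr pair; apply/ffunP => -[[i j] /= ij]; rewrite !ffunE /= -val_eqE /=.
case: e => -[a b] /= ab; rewrite -!natrM !mulnb xpair_eqE.
have [/andP[/eqP ia /eqP jb]|_] := boolP ((j == a) && (i == b)); last by rewrite subr0.
by move: ij (arc_asym ab); rewrite ia jb => ->.
Qed.

Lemma graph_bracket_nonadj (i j : V) : ~~ arc G i j -> ~~ arc G j i ->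
  graph_bracket (vertex_vec i) (vertex_vec j) = 0.
Proof.
move=> nij nji; congr pair; apply/ffunP => -[[a b] /= ab]; rewrite !ffunE /=.
rewrite -!natrM !mulnb.
have [/andP[/eqP ai /eqP bj]|_] := boolP ((a == i) && (b == j)).
  by rewrite -ai -bj ab in nij.
have [/andP[/eqP bi /eqP aj]|_] := boolP ((b == i) && (a == j)).
  by rewrite -bi -aj ab in nji.
by rewrite subrr.
Qed.

Lemma graph_bracket_central (x y : graph_space) : x.1 = 0 -> graph_bracket x y = 0.
Proof.
move=> x0; congr pair; apply/ffunP => e.
by rewrite !ffunE x0 !ffunE !mul0r subrr.
Qed.

Lemma graph_bracket_alternating x : graph_bracket x x = 0.
Proof.
by congr pair; apply/ffunP => e; rewrite !ffunE mulrC subrr.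
Qed.

Lemma graph_bracket_anti x y : graph_bracket x y = - graph_bracket y x.
Proof.
congr pair; first by rewrite oppr0.
by apply/ffunP => e; rewrite !ffunE opprB mulrC [X in _ - X]mulrC.
Qed.

Lemma graph_bracket_is_bilinear :
  bilinear_for (GRing.Scale.Law.clone _ _ ( *:%R ) _)
               (GRing.Scale.Law.clone _ _ ( *:%R ) _) graph_bracket.
Proof.
have linl y : linear (graph_bracket^~ y).
  move=> a u v; congr pair => /=; first by rewrite scaler0 addr0.
  apply/ffunP => e; rewrite !ffunE /= /GRing.scale /=.
  by rewrite !mulrDl mulrBr opprD addrACA !mulrA.
split=> // x a u v /=.
by rewrite graph_bracket_anti linl opprD -scalerN -!graph_bracket_anti.
Qed.

HB.instance Definition _ :=
  bilinear_isBilinear.Build F graph_space graph_space graph_space _ _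
    graph_bracket graph_bracket_is_bilinear.

Lemma graph_bracket_jacobi x y z :
  graph_bracket x (graph_bracket y z) + graph_bracket y (graph_bracket z x)
    + graph_bracket z (graph_bracket x y) = 0.
Proof.
have br0 a b c : graph_bracket a (graph_bracket b c) = 0.
  by rewrite graph_bracket_anti graph_bracket_central // oppr0.
by rewrite !br0 !addr0.
Qed.

Definition graph_lie : lie_algebra F :=
  @LieAlgebra F graph_space graph_bracket
    graph_bracket_alternating graph_bracket_jacobi.

Lemma graph_lie_two_step (e : edge) : two_step_nilpotent graph_lie.
Proof.
split; last by move=> x y z; exact: graph_bracket_central.
exists (vertex_vec (val e).1), (vertex_vec (val e).2).
rewrite /= graph_bracket_edge; apply/eqP => /(congr1 (fun p : graph_space => p.2 e)).
by rewrite !ffunE eqxx; apply/eqP/oner_neq0.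
Qed.

End GraphLie.

(* Main.v *)
(* A functional l restricts to a skew form on the span v of the vertices, and
   its stabiliser is the radical of that form plus the span z of the edges.  As
   dim v is odd, the radical is never 0.  If the Gram matrix of l with one column
   replaced by a column of the Gram matrix of m is invertible, then the radical
   of l is a line spanned by some w, and w is not in the radical of m.  When the
   same holds with l and m exchanged, [n_l, n_m] is spanned by [w, w'], which is
   nonzero because w and w' are independent and the graph is complete.  Both
   conditions are the nonvanishing of a nonzero polynomial, so they define a
   dense open set of pairs, on which dim [n_l, n_m] = 1 throughout. *)

From HB Require Import structures.
Require Import Defs.
From mathcomp Require Import all_boot all_order all_algebra.
From mathcomp Require Import all_classical all_reals all_analysis.

Set Implicit Arguments.
Unset Strict Implicit.
Unset Printing Implicit Defensive.

Import Order.TTheory GRing.Theory Num.Theory.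
Import numFieldNormedType.Exports.
Import VectorInternalTheory.
Local Open Scope classical_set_scope.
Local Open Scope ring_scope.

(** * Topology: the locus where a determinant is nonzero *)

Section ZariskiOpen.
Variables (R : realType) (W : vectType R).

Lemma fd_openI (U1 U2 : set W) :
  fd_open U1 -> fd_open U2 -> fd_open (U1 `&` U2).
Proof. exact: openI. Qed.

Lemma fd_denseI (U1 U2 : set W) :
  fd_open U1 -> fd_dense U1 -> fd_dense U2 -> fd_dense (U1 `&` U2).
Proof.
move=> oU1 dU1 dU2 O O0 oO.
have [||p [[Op U1p] U2p]] := dU2 (O `&` U1); [exact: dU1|exact: fd_openI|].
by exists p.
Qed.

Lemma linear_row_continuous d (g : {linear 'rV[R]_d -> R^o}) :
  continuous (g : 'rV[R]_d -> R).
Proof.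
have -> : (g : 'rV[R]_d -> R) = fun x => \sum_i x 0 i * g (delta_mx 0 i).
  apply/funext => x; rewrite {1}(row_sum_delta x) linear_sum.
  by apply: eq_bigr => i _; rewrite linearZ.
apply: (continuous_big (@add_continuous R)) => i _.
rewrite -[X in continuous X]/(fun x : 'rV[R]_d => x 0 i * _) => x.
exact: (cvgMr_tmp (@coord_continuous R 1 d 0 i x)).
Qed.

Lemma det_continuous (T : topologicalType) N (A : T -> 'M[R]_N) :
  (forall i j, continuous (fun x => A x i j)) ->
  continuous (fun x => \det (A x)).
Proof.
move=> Acont; apply: (continuous_big (@add_continuous R)) => s _ x.
apply: cvgMl_tmp; apply: (continuous_big (@mul_continuous R)) => i _.
exact: Acont.
Qed.

Variables (N : nat) (A : {linear W -> 'M[R]_N}).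

Lemma fd_open_det : fd_open [set p | \det (A p) != 0].
Proof.
rewrite /fd_open; set f := _ @^-1` _.
have -> : f = (fun x => \det (A (r2v x))) @^-1` [set y | y != 0] by [].
apply: open_comp; last exact: open_neq.
move=> x _; apply: det_continuous => i j {}x.
have lin : linear (fun x => A (r2v x) i j : R^o).
  by move=> a u v; rewrite !linearP !mxE.
pose B := GRing.isLinear.Build R _ R^o _ _ lin.
pose h : {linear 'rV[R]_(dim W) -> R^o} :=
  HB.pack (fun x => A (r2v x) i j : R^o) B.
exact: (@linear_row_continuous _ h).
Qed.

Lemma fd_dense_det p1 : \det (A p1) != 0 -> fd_dense [set p | \det (A p) != 0].
Proof.
move=> Ap1 O [p0 Op0] oO.
(* The determinant restricted to the line through p0 and p1 has finitely many
   zeros, so it is nonzero at points of the line arbitrarily close to p0. *)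
pose q : {poly R} :=
  \det (map_mx polyC (A p0) + 'X *: map_mx polyC (A (p1 - p0))).
have qE t : q.[t] = \det (A (p0 + t *: (p1 - p0))).
  rewrite -horner_evalE -det_map_mx; congr (\det _).
  have -> : A (p0 + t *: (p1 - p0)) = t *: A (p1 - p0) + A p0.
    by rewrite addrC; exact: linearP.
  by apply/matrixP => i j; rewrite !mxE /= /horner_eval !hornerE addrC.
have q0 : q != 0.
  apply: contraNneq Ap1 => q0; have := qE 1.
  by rewrite q0 horner0 scale1r addrC subrK => <-.
have : \forall t \near (0 : R), O (p0 + t *: (p1 - p0)).
  have : (v2r p0 + t *: v2r (p1 - p0)) @[t --> (0 : R)] --> v2r p0.
    rewrite -[X in _ --> X]addr0 -(scale0r (v2r (p1 - p0))).
    by apply: cvgD; [exact: cvg_cst|apply: cvgZr_tmp; exact: cvg_id].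
  have nO : nbhs (v2r p0) (r2v @^-1` O).
    by apply: open_nbhs_nbhs; split=> //=; rewrite v2rK.
  move=> /(_ _ nO) Onear; apply: (@filterS _ (nbhs (0 : R)) _ _ _ _ Onear) => t.
  have <- : r2v (v2r p0 + t *: v2r (p1 - p0)) = p0 + t *: (p1 - p0); last by [].
  apply: v2r_inj; rewrite r2vK addrC [in RHS]addrC.
  by apply/esym; exact: linearP.
move=> /nbhs_ballP[e /= e0 eO].
(* These are [size q] distinct points, more than the roots of [q]; denominators start at 2 so that
   all lie strictly inside the ball of radius [e]. *)
pose rs := [seq e / i.+2%:R | i <- iota 0 (size q)].
have urs : uniq rs.
  rewrite map_inj_uniq ?iota_uniq// => i j /=.
  move=> /(mulfI (lt0r_neq0 e0))/invr_inj/eqP.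
  by rewrite eqr_nat => /eqP[].
have : ~~ all (root q) rs.
  apply/negP => /(max_poly_roots q0)/(_ urs).
  by rewrite size_map size_iota ltnn.
move=> /allPn[_ /mapP[i _ ->] rti].
exists (p0 + (e / i.+2%:R) *: (p1 - p0)); split.
  apply: eO; rewrite /ball /= sub0r normrN gtr0_norm ?divr_gt0//.
  by rewrite gtr_pMr// invf_lt1// ltr1n.
by rewrite /= -qE.
Qed.

End ZariskiOpen.

Lemma sum_enum_val (M : nmodType) (T : finType) (f : T -> M) :
  \sum_i f i = \sum_(j < #|T|) f (enum_val j).
Proof. by rewrite (reindex (@enum_val T T)) //; exact/onW_bij/enum_val_bij. Qed.

(** * Skew forms on the vertex span and their radicals *)

Section GraphForms.
Variables (F : fieldType) (V : finType) (G : digraph V).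

Local Notation n := (graph_lie F G).
Local Notation dual := 'Hom(n, F^o).
Local Notation br := (@bracket F n).
Local Notation X := (vertex_vec F G : V -> n).
Local Notation coef x := (x.1 : {ffun V -> F^o}).
Implicit Types (l m : dual) (x y : n) (p : dual * dual).

Lemma graph_bracketC x y : br x y = - br y x.
Proof. exact: graph_bracket_anti. Qed.

Lemma formC l x y : l (br x y) = - l (br y x).
Proof. by rewrite graph_bracketC; exact: linearN. Qed.

Lemma graph_bracket_sum x y : br x y = \sum_i coef x i *: br (X i) y.
Proof.
(* [x'] differs from [x] by an element of the span of the edges, which is central. *)
pose x' : n := \sum_i coef x i *: X i.
have x'1 : x'.1 = x.1.
  apply/ffunP => j.
  rewrite (linear_sum (fst : graph_space F G -> {ffun V -> F^o})).
  rewrite sum_ffunE (bigD1 j)//= !ffunE eqxx big1 ?addr0.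
    by rewrite /GRing.scale /= mulr1.
  by move=> i /negPf ij; rewrite !ffunE eq_sym ij /GRing.scale /= mulr0.
have -> : br x y = br x' y by rewrite /= /graph_bracket x'1.
by rewrite linear_sumlz; apply: eq_bigr => i _; rewrite linearZl_LR.
Qed.

Lemma form_sum l x y :
  l (br x y) = \sum_i coef x i * l (br (X i) y).
Proof.
by rewrite graph_bracket_sum linear_sum; apply: eq_bigr => i _; rewrite linearZ.
Qed.

Lemma mem_stabP l x : reflect (forall i, l (br x (X i)) = 0) (x \in stab l).
Proof.
rewrite mem_stab; apply: (iffP eqP) => [xl i|xl].
  have /lfunP/(_ (X i)) := xl.
  by rewrite ad_starE zero_lfunE => /eqP; rewrite oppr_eq0 => /eqP.
apply/lfunP => y; rewrite ad_starE zero_lfunE formC opprK.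
rewrite form_sum big1 // => i _.
by rewrite formC xl oppr0 mulr0.
Qed.

(** A skew Gram matrix [A] of odd size satisfies det A = - det A, hence is singular when 2 is
    invertible; a vector in its left kernel supplies the vertex coordinates of [w]. *)
Lemma stab_vertex_part l : 2 != 0 :> F -> odd #|V| ->
  exists2 w, w \in stab l & w.1 != 0.
Proof.
move=> F2 oddV.
pose A : 'M[F]_#|V| := \matrix_(i, j) l (br (X (enum_val i)) (X (enum_val j))).
have AT : A^T = - A.
  by apply/matrixP => i j; rewrite !mxE formC.
have : \det A == 0.
  have := det_tr A; rewrite AT -scaleN1r detZ -signr_odd oddV expr1 mulN1r.
  move=> /eqP; rewrite eq_sym -addr_eq0 -mulr2n -mulr_natl mulf_eq0 (negPf F2).
  by [].
move=> /det0P[v v0 vA].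
pose x : n := ([ffun i => v 0 (enum_rank i)], 0).
have xi i : coef x i = v 0 (enum_rank i) by rewrite ffunE.
exists x.
  apply/mem_stabP => i; rewrite form_sum sum_enum_val.
  have /rowP/(_ (enum_rank i)) := vA; rewrite !mxE => vAi; rewrite -[RHS]vAi.
  by apply: eq_bigr => j _; rewrite xi enum_valK mxE enum_rankK.
apply: contraNneq v0 => x0; apply/eqP/rowP => i; have := xi (enum_val i).
by rewrite x0 enum_valK ffunE mxE => <-.
Qed.

Lemma form_delta l x y i c :
  (forall j, l (br (X j) y) = (j == i)%:R * c) -> l (br x y) = coef x i * c.
Proof.
move=> lE; rewrite form_sum (bigD1 i)//= lE eqxx mul1r big1 ?addr0// => j.
move/negPf=> ji.
by rewrite lE ji mul0r mulr0.
Qed.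

(** * Transversality of two forms as invertibility of a matrix *)

Section MixedMatrix.
Variables (i0 i1 : V).

(* The Gram matrix of p.1 with its column i0 replaced by column i1 of the Gram
   matrix of p.2. *)
Definition mixed_mx p : 'M[F]_#|V| :=
  \matrix_(i, j) if enum_val j == i0 then p.2 (br (X (enum_val i)) (X i1))
                 else p.1 (br (X (enum_val i)) (X (enum_val j))).

Lemma mixed_mx_is_linear : linear mixed_mx.
Proof.
move=> a p q; apply/matrixP => i j; rewrite !mxE.
by case: ifP => _; rewrite /= add_lfunE scale_lfunE.
Qed.

HB.instance Definition _ :=
  GRing.isLinear.Build F (dual * dual)%type 'M[F]_#|V| _
    mixed_mx mixed_mx_is_linear.

Lemma mul_mixed_mx (v : 'rV_#|V|) x p j :
  (forall i, v 0 i = coef x (enum_val i)) ->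
  (v *m mixed_mx p) 0 j = if enum_val j == i0 then p.2 (br x (X i1))
                          else p.1 (br x (X (enum_val j))).
Proof.
move=> vx; rewrite mxE.
have sumE l y : l (br x y) = \sum_i v 0 i * l (br (X (enum_val i)) y).
  rewrite [LHS]form_sum sum_enum_val.
  by apply: eq_bigr => i _; rewrite vx.
by case: ifP => ji0; rewrite sumE; apply: eq_bigr => i _; rewrite mxE ji0.
Qed.

(** Invertibility is triviality of the left kernel, where row vectors are vertex parts and each
    column gives one equation. *)
Lemma det_mixed_mxP p :
  reflect (forall x, (forall j, j != i0 -> p.1 (br x (X j)) = 0) ->
             p.2 (br x (X i1)) = 0 -> x.1 = 0)
          (\det (mixed_mx p) != 0).
Proof.
apply: (iffP idP) => [dp x x1 x2|dp].
  pose v : 'rV[F]_#|V| := \row_i coef x (enum_val i).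
  have vx i : v 0 i = coef x (enum_val i) by rewrite mxE.
  have v0 : v = 0.
    apply: contraNeq dp => v0; apply/det0P; exists v => //.
    apply/rowP => j; rewrite (mul_mixed_mx _ _ vx) mxE.
    by case: ifPn => // /x1.
  apply/ffunP => i; have := vx (enum_rank i).
  by rewrite v0 enum_rankK mxE ffunE => <-.
apply/negP => /det0P[v v0 vp].
pose x : n := ([ffun i => v 0 (enum_rank i)], 0).
have vx i : v 0 i = coef x (enum_val i) by rewrite ffunE enum_valK.
have xp j := mul_mixed_mx p (enum_rank j) vx.
move/negP : v0; apply; apply/eqP/rowP => i; rewrite mxE vx dp ?ffunE//.
  move=> j ji0; have := xp j.
  by rewrite vp mxE enum_rankK (negPf ji0).
by have := xp i0; rewrite vp mxE enum_rankK eqxx.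
Qed.

End MixedMatrix.

(** * Complete graphs: an explicit transversal pair, and collinearity *)

Hypothesis completeG : complete_graph G.

(** The brackets of distinct vertices are, up to sign, the basis vectors of the edge span, so a
    functional may be prescribed freely on them. *)
Lemma form_coef (a : V -> V -> F) : (forall i j, a i j = - a j i) ->
  (forall i, a i i = 0) ->
  exists l : dual, forall i j, l (br (X i) (X j)) = a i j.
Proof.
move=> aC a0.
pose f (y : n) : F^o :=
  \sum_(e : edge G) (y.2 : {ffun edge G -> F^o}) e * a (val e).1 (val e).2.
have flin : linear f.
  move=> c u v; rewrite /f scaler_sumr -big_split /=; apply: eq_bigr => e _.
  by rewrite !ffunE mulrDl /GRing.scale /= mulrA.
pose B := GRing.isLinear.Build F n F^o _ _ flin.
pose h : {linear n -> F^o} := HB.pack f B.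
have hE (e : edge G) :
    (linfun h : dual) (br (X (val e).1) (X (val e).2)) = a (val e).1 (val e).2.
  rewrite lfunE /= graph_bracket_edge /f (bigD1 e)//= ffunE eqxx mul1r.
  rewrite big1 ?addr0// => e' e'e.
  by rewrite ffunE (negPf e'e) mul0r.
exists (linfun h) => i j.
have [<-|ij] := eqVneq i j; first by rewrite bracket_alternating linear0 a0.
have /orP[ij1|ij1] := completeG ij; first exact: (hE (Sub (i, j) ij1)).
by rewrite formC aC; congr (- _); exact: (hE (Sub (j, i) ij1)).
Qed.

Lemma mixed_mx_neq0 : odd #|V| -> (1 < #|V|)%N ->
  exists i0 i1, exists p : dual * dual, \det (mixed_mx i0 i1 p) != 0.
Proof.
move=> oddV V1; pose rk (i : V) : nat := enum_rank i.
have rk_inj : injective rk by move=> i j /val_inj/enum_rank_inj.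
have rk_surj t : (t < #|V|)%N -> {j | rk j = t}.
  by move=> tV; exists (enum_val (Ordinal tV)); rewrite /rk enum_valK.
(* The form a pairs the vertices of rank 1 and 2, 3 and 4, ..., so that its
   kernel is the line of the vertex of rank 0, on which the form b is nonzero. *)
pose a i j : F := (odd (rk i) && (rk j == (rk i).+1))%:R
                  - (odd (rk j) && (rk i == (rk j).+1))%:R.
pose b i j : F := ((rk i == 0%N) && (rk j == 1%N))%:R
                  - ((rk j == 0%N) && (rk i == 1%N))%:R.
have [l lE] : exists l : dual, forall i j, l (br (X i) (X j)) = a i j.
  by apply: form_coef => [i j|i]; rewrite /a ?opprB ?subrr.
have [m mE] : exists m : dual, forall i j, m (br (X i) (X j)) = b i j.
  by apply: form_coef => [i j|i]; rewrite /b ?opprB ?subrr.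
have [i0 i0E] := rk_surj 0%N (ltnW V1); have [i1 i1E] := rk_surj 1%N V1.
exists i0, i1, (l, m); apply/det_mixed_mxP => x /= lx mx.
apply/ffunP => i; rewrite [RHS]ffunE.
case: (posnP (rk i)) => [ri|ri].
  rewrite (@form_delta m x _ i 1) ?mulr1// in mx => j.
  by rewrite mE /b i1E eqxx andbT/= subr0 mulr1 -ri (inj_eq rk_inj).
have [iodd|ieven] := boolP (odd (rk i)).
  have [|j jE] := rk_surj (rk i).+1.
    (* A vertex of odd rank is not the last one, since the last rank is even; its partner is
       therefore its successor. *)
    rewrite ltn_neqAle ltn_ord andbT; apply: contraTneq oddV => <-.
    by rewrite /= iodd.
  have ji0 : j != i0 by apply: contra_eq_neq jE => ->; rewrite i0E.
  have := lx j ji0; rewrite (@form_delta l x _ i 1) ?mulr1// => i'.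
  rewrite lE /a jE /= iodd /= subr0 mulr1 eqSS.
  rewrite (inj_eq rk_inj) eq_sym.
  by case: eqVneq => [->|]; rewrite ?iodd ?andbF.
(* For positive even rank the partner is the predecessor, and the form takes the value -1. *)
have [|j jE] := rk_surj (rk i).-1.
  exact: leq_ltn_trans (leq_pred _) (ltn_ord _).
have rj : rk i = (rk j).+1 by rewrite jE prednK.
have jodd : odd (rk j) by rewrite -[odd _]negbK -oddS -rj.
have ji0 : j != i0 by apply: contraTneq jodd => ->; rewrite i0E.
have := lx j ji0; rewrite (@form_delta l x _ i (-1)).
  by rewrite mulrN1 => /eqP; rewrite oppr_eq0 => /eqP.
move=> i'; rewrite lE /a jodd -rj (inj_eq rk_inj) mulrN1.
have [ji'|] := eqVneq (rk j) (rk i').+1; last by rewrite andbF sub0r.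
by move: jodd; rewrite ji' /= => /negPf->; rewrite sub0r.
Qed.

(** By completeness, the edge coordinates of [br x y] are, up to sign, all the 2 by 2 minors of the
    two vertex parts. *)
Lemma collinear_vertex_part (x y : n) : br x y = 0 -> y.1 != 0 ->
  exists c, x.1 = c *: y.1.
Proof.
move=> xy0 y0; have [j yj] : exists j, coef y j != 0.
  apply/existsP; apply: contraNT y0; rewrite negb_exists => /forallP y0.
  by apply/eqP/ffunP => j; have := y0 j; rewrite negbK ffunE => /eqP.
exists (coef x j / coef y j); apply/ffunP => i.
rewrite ffunE /GRing.scale /= mulrAC; apply: (canRL (mulfK yj)).
have xyE (e : edge G) : coef x (val e).1 * coef y (val e).2
    = coef x (val e).2 * coef y (val e).1.
  have /(congr1 (fun z : graph_space F G => (z.2 : {ffun _ -> _}) e)) := xy0.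
  by rewrite !ffunE => /eqP; rewrite subr_eq0 => /eqP.
have [->//|ij] := eqVneq i j.
have /orP[ij1|ij1] := completeG ij; first exact: (xyE (Sub (i, j) ij1)).
by apply/esym; exact: (xyE (Sub (j, i) ij1)).
Qed.

(** * Shape of the stabilisers of a transversal pair *)

Definition edge_space : {vspace n} :=
  lker (linfun (fst : graph_space F G -> {ffun V -> F^o})).

Lemma mem_edge_space x : (x \in edge_space) = (x.1 == 0).
Proof. by rewrite memv_ker lfunE. Qed.

Lemma bracket_edge_spacel x y : x \in edge_space -> br x y = 0.
Proof. by rewrite mem_edge_space => /eqP; exact: graph_bracket_central. Qed.

Lemma bracket_edge_spacer x y : y \in edge_space -> br x y = 0.
Proof. by move=> yZ; rewrite graph_bracketC bracket_edge_spacel// oppr0. Qed.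

Lemma edge_space_sub_stab l : (edge_space <= stab l)%VS.
Proof.
apply/subvP => x /bracket_edge_spacel xZ.
by apply/mem_stabP => i; rewrite xZ linear0.
Qed.

Lemma dim_edge_space_line w : w.1 != 0 ->
  \dim (edge_space + <[w]>) = (\dim edge_space).+1.
Proof.
move=> w0; have wn0 : w != 0 by apply: contraNneq w0 => ->.
rewrite dimv_disjoint_sum ?dim_vline ?wn0 ?addn1//.
apply/eqP; rewrite -subv0; apply/subvP => x; rewrite memv_cap => /andP[].
rewrite mem_edge_space => /eqP x0 /vlineP[c xE]; move: x0; rewrite xE memv0 /=.
move/eqP; rewrite scaler_eq0 (negPf w0) orbF => /eqP->.
by rewrite scale0r.
Qed.

Variables (i0 i1 : V) (l m : dual).
Hypothesis lm_mixed : \det (mixed_mx i0 i1 (l, m)) != 0.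

(** A vector of [stab l] already satisfies every equation of the mixed matrix except possibly the
    one contributed by [m]. *)
Lemma mixed_transversal w : w \in stab l -> w.1 != 0 -> m (br w (X i1)) != 0.
Proof.
move=> /mem_stabP wl; apply: contraNneq => wm.
by apply/eqP; apply: (det_mixed_mxP _ _ _ lm_mixed) => //= j _; exact: wl.
Qed.

Lemma stab_mixed w : w \in stab l -> w.1 != 0 ->
  stab l = (edge_space + <[w]>)%VS.
Proof.
move=> wl w0; have mw := mixed_transversal wl w0.
apply/eqP; rewrite eqEsubv subv_add edge_space_sub_stab -memvE wl !andbT.
(* This [c] makes [m] vanish on the bracket of [x - c *: w] with [X i1], which forces the vertex
   part of that difference to be 0. *)
apply/subvP => x xl; pose c := m (br x (X i1)) / m (br w (X i1)).
have yl : x - c *: w \in stab l by rewrite memvB ?memvZ.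
rewrite -(subrK (c *: w) x); apply: memv_add; last by rewrite memvZ ?memv_line.
rewrite mem_edge_space; apply: contraTT (mw) => /(mixed_transversal yl).
rewrite linearBl linearZl_LR linearB linearZ /= /GRing.scale /= divfK//.
by rewrite subrr eqxx.
Qed.

End GraphForms.

(** * Regularity, and the dimension of the bracket of two stabilisers *)

Section OddCompleteGraph.
Variables (R : realType) (V : finType) (G : digraph V).
Hypotheses (completeG : complete_graph G) (oddV : odd #|V|).

Local Notation n := (graph_lie R G).
Local Notation dual := 'Hom(n, R^o).
Local Notation br := (@bracket R n).
Implicit Types (l m : dual).

Let stab_vertex l : exists2 w, w \in stab l & w.1 != 0.
Proof. by apply: stab_vertex_part => //; rewrite pnatr_eq0. Qed.

(** Since [#|V|] is odd, every stabiliser contains the edge span and one further line; here [stab l]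
    is no larger. *)
Lemma regular_mixed i0 i1 l m : \det (mixed_mx i0 i1 (l, m)) != 0 -> regular l.
Proof.
move=> lm l'; have [w wl w0] := stab_vertex l.
have [w' wl' w0'] := stab_vertex l'.
rewrite (stab_mixed lm wl w0) dim_edge_space_line// -(dim_edge_space_line w0').
by apply: dimvS; rewrite subv_add edge_space_sub_stab -memvE.
Qed.

Lemma dim_brackv_mixed i0 i1 l m : \det (mixed_mx i0 i1 (l, m)) != 0 ->
  \det (mixed_mx i0 i1 (m, l)) != 0 -> \dim (brackv (stab l) (stab m)) = 1%N.
Proof.
move=> lm ml; have [w wl w0] := stab_vertex l.
have [w' wm w0'] := stab_vertex m.
have ww' : br w w' != 0.
  (* Otherwise [w] would be a multiple of [w'] modulo edges, hence in [stab m], against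
     transversality. *)
  apply: contraNneq (mixed_transversal lm wl w0) => ww0.
  have [c wE] := collinear_vertex_part completeG ww0 w0'.
  have -> : br w (vertex_vec R G i1) = br (c *: w') (vertex_vec R G i1).
    by rewrite /= /graph_bracket wE.
  by rewrite linearZl_LR linearZ /= (mem_stabP _ _ wm) scaler0.
suff -> : brackv (stab l) (stab m) = <[br w w']>%VS by rewrite dim_vline ww'.
apply/eqP; rewrite eqEsubv -memvE memv_brackv// andbT.
apply/brackvP => u v; rewrite (stab_mixed lm wl w0) (stab_mixed ml wm w0').
move=> /memv_addP[z zZ [_ /vlineP[a ->] ->]].
move=> /memv_addP[z' zZ' [_ /vlineP[b ->] ->]].
rewrite linearDl bracket_edge_spacel// add0r.
rewrite linearDr bracket_edge_spacer// add0r.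
by rewrite linearZl_LR linearZr_LR /= !memvZ ?memv_line.
Qed.

Lemma nonintegrable_odd : (1 < #|V|)%N -> nonintegrable n.
Proof.
move=> V1; have [i0 [i1 [[l1 m1] lm1]]] := mixed_mx_neq0 R completeG oddV V1.
pose f : {linear (dual * dual)%type -> 'M[R]_#|V|} := mixed_mx i0 i1.
have glin : linear (fun p : (dual * dual)%type => mixed_mx i0 i1 (p.2, p.1)).
  by move=> a p q; rewrite -linearP.
pose B := GRing.isLinear.Build R (dual * dual)%type 'M[R]_#|V| _ _ glin.
pose g : {linear (dual * dual)%type -> 'M[R]_#|V|} :=
  HB.pack (fun p : (dual * dual)%type => mixed_mx i0 i1 (p.2, p.1)) B.
pose U := [set p | \det (f p) != 0] `&` [set p | \det (g p) != 0].
have oU : fd_open U by apply: fd_openI; exact: fd_open_det.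
have dimU l m : U (l, m) -> \dim (brackv (stab l) (stab m)) = 1%N.
  by move=> [lm ml]; exact: dim_brackv_mixed lm ml.
exists U; split=> //.
- apply: fd_denseI; first exact: fd_open_det.
    exact: (@fd_dense_det _ _ _ f (l1, m1)).
  exact: (@fd_dense_det _ _ _ g (m1, l1)).
- move=> l m Ulm; have [lm ml] := Ulm.
  split; [exact: regular_mixed lm|exact: regular_mixed ml|].
  (* [U] is its own neighbourhood of local minimality, the dimension being 1 throughout. *)
  by exists U; split=> // l' m' /dimU->; rewrite dimU.
- by move=> l m /dimU; rewrite -dimv_eq0 => ->.
Qed.

End OddCompleteGraph.

Theorem proposition2p12 (R : realType) (k n : nat) (V : finType)
    (G : digraph V) (hk : (1 <= k)%N) (hn : n = (2 * k + 1)%N)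
    (hV : #|V| = n) (hG : complete_graph G) :
  nonintegrable (graph_lie R G).
Proof.
apply: nonintegrable_odd => //; rewrite hV hn addn1 ?ltnS ?muln_gt0//.
by rewrite /= oddM.
Qed.
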